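(* Let $m$ be a positive integer and $q=2^m$. Then $$f(x)=x+x^{2q^2+2}+x^{2q+2}+x^{2}+x^{2q}$$ is a permutation polynomial over $\mathbb{F}_{q^3}$.
   Context: $\mathbb{F}_{q^3}$ denotes the finite field with $q^3$ elements. A polynomial $f\in\mathbb{F}_{q^3}[x]$ is a permutation polynomial over $\mathbb{F}_{q^3}$ if the associated map $c\mapsto f(c)$ from $\mathbb{F}_{q^3}$ to itself is a bijection. *)

(* Defs.v *)
From HB Require Import structures.
From mathcomp Require Import all_boot all_order all_algebra all_field.

Set Implicit Arguments.
Unset Strict Implicit.
Unset Printing Implicit Defensive.

Import GRing.Theory.
Local Open Scope ring_scope.

Definition permutation_poly (F : finFieldType) (f : {poly F}) : Prop :=
  bijective (fun c : F => f.[c]).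

(* Main.v *)
(** Let [sigma] be the q-power Frobenius and, for [x] in the field, put
    [y = sigma x] and [z = sigma y].  In characteristic 2 the map is
    [x + (x z + x y + x + y)^2].  If [x] and [x + a] have the same image, put
    [b = sigma a] and [c = sigma b]; adding the three conjugates of this
    equality gives [a + b + c = 0], which turns it into
    [b^2 = a^4 + (S^2 + 1) a^2 + a] with [S = x + y + z].  Let
    [e = a b + b c + c a] and [n = a b c], so that [a^3 + e a + n = 0], and put
    [r = S^2 + n].  Elimination shows that, if [a] is nonzero, the roots of this
    cubic are [1/r], [1/(r+1)] and [1/(r^2+r)].  As [r] is fixed by [sigma], so
    is [a], whence [a = a + b + c = 0]. *)
From HB Require Import structures.
Require Import Defs.
From mathcomp Require Import all_boot all_order all_algebra all_field.
From mathcomp Require Import ring.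

Set Implicit Arguments.
Unset Strict Implicit.
Unset Printing Implicit Defensive.

Import GRing.Theory.
Local Open Scope ring_scope.

Lemma natr_pchar2 (R : nzSemiRingType) (n : nat) :
  2%N \in [pchar R] -> n%:R = (odd n)%:R :> R.
Proof. by move=> charR; rewrite -(GRing.natr_mod_pchar charR n) modn2. Qed.

(* [ring: h] rewrites only coefficients equal to the left-hand side of [h], so
   each integer that may occur as a coefficient is given its own equation. *)
Ltac ring_pchar2 charR :=
  let h2 := fresh in let h3 := fresh in let h4 := fresh in let h5 := fresh in
  let h6 := fresh in let h7 := fresh in let h8 := fresh in let h9 := fresh in
  have h2 := natr_pchar2 2 charR; have h3 := natr_pchar2 3 charR;
  have h4 := natr_pchar2 4 charR; have h5 := natr_pchar2 5 charR;
  have h6 := natr_pchar2 6 charR; have h7 := natr_pchar2 7 charR;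
  have h8 := natr_pchar2 8 charR; have h9 := natr_pchar2 9 charR;
  rewrite /= ?mulr0n ?mulr1n in h2 h3 h4 h5 h6 h7 h8 h9;
  ring: h2 h3 h4 h5 h6 h7 h8 h9.

Section CharacteristicTwo.

Variable F : fieldType.
Hypothesis charF : 2%N \in [pchar F].

Let addrr_eq0 (x y : F) : (x + y == 0) = (x == y).
Proof. by rewrite -(GRing.subr_pchar2 charF) subr_eq0. Qed.

(* The hypotheses say that [a] and [b] satisfy [b^2 = P a^2 + Q a] and
   [c^2 = P b^2 + Q b] with [c = a + b], [P = e + s] and [Q = n + 1].  The two
   conclusions come from substituting these relations, and the implied
   [a^2 = P c^2 + Q c], into the cyclic sums of [a^2 b^2], and of [a b^2] and
   [a^2 b], respectively. *)
Lemma conjugates_elim (s a b : F) :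
    let e := a ^+ 2 + a * b + b ^+ 2 in
    let n := a * b * (a + b) in
    b ^+ 2 + a ^+ 4 + s * a ^+ 2 + a = 0 ->
    (a + b) ^+ 2 + b ^+ 4 + s * b ^+ 2 + b = 0 ->
  e ^+ 2 = n ^+ 2 + n /\ n * (1 + (e + s) + (e + s) ^+ 2) = (n + 1) * e.
Proof.
move=> e n E1 E2; split; apply/eqP; rewrite -addrr_eq0; apply/eqP.
  transitivity (b ^+ 2 * (b ^+ 2 + a ^+ 4 + s * a ^+ 2 + a)
              + a ^+ 2 * ((a + b) ^+ 2 + b ^+ 4 + s * b ^+ 2 + b)).
    by rewrite /e /n; ring_pchar2 charF.
  by rewrite E1 E2 !mulr0 addr0.
transitivity ((a + b + (e + s) * b) * (b ^+ 2 + a ^+ 4 + s * a ^+ 2 + a)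
            + ((e + s) * a + b) * ((a + b) ^+ 2 + b ^+ 4 + s * b ^+ 2 + b)).
  by rewrite /e /n; ring_pchar2 charF.
by rewrite E1 E2 !mulr0 addr0.
Qed.

(** With [k = r^2 + r], elimination gives [n k = n + e], hence [n k^2 = 1] and [e k^2 = k + 1]. So
    [k^2] times the identity [a^3 + e a + n = 0] reads [k^2 a^3 + (k + 1) a + 1 = 0], which factors
    as [k = r (r + 1)]. *)
Lemma conjugates_split (s a b : F) :
    let n := a * b * (a + b) in
    let r := s + n + 1 in
    n != 0 ->
    b ^+ 2 + a ^+ 4 + s * a ^+ 2 + a = 0 ->
    (a + b) ^+ 2 + b ^+ 4 + s * b ^+ 2 + b = 0 ->
  (r * a + 1) * ((r + 1) * a + 1) * ((r ^+ 2 + r) * a + 1) = 0.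
Proof.
move=> n r n_neq0 E1 E2; have [e2E pE] := conjugates_elim E1 E2.
set e := a ^+ 2 + a * b + b ^+ 2 in e2E pE; rewrite -/n in e2E pE.
set k := r ^+ 2 + r.
have nkE : n * k = n + e.
  apply/eqP; rewrite -addrr_eq0; apply/eqP.
  transitivity ((n * (1 + (e + s) + (e + s) ^+ 2) + (n + 1) * e)
                + n * (e ^+ 2 + (n ^+ 2 + n))).
    by rewrite /k /r; move: e n {n_neq0 r k e2E pE} => e n; ring_pchar2 charF.
  by rewrite pE e2E !(GRing.addrr_pchar2 charF) mulr0 addr0.
have nk2E : n * k ^+ 2 = 1.
  apply: (mulfI n_neq0); rewrite mulrA -expr2 -exprMn nkE mulr1.
  transitivity (n ^+ 2 + e ^+ 2); first by ring_pchar2 charF.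
  by rewrite e2E addrA (GRing.addrr_pchar2 charF) add0r.
have ek2E : k = 1 + e * k ^+ 2.
  by rewrite -[1]nk2E -mulrDl -nkE mulrAC nk2E mul1r.
transitivity (k ^+ 2 * (a ^+ 3 + e * a + n)); last first.
  by rewrite (_ : _ + n = 0) ?mulr0 // /e /n; ring_pchar2 charF.
transitivity (k ^+ 2 * a ^+ 3 + (k + 1) * a + 1).
  by rewrite /k; move: r {k nkE nk2E ek2E} => r; ring_pchar2 charF.
rewrite {2}ek2E -nk2E; ring_pchar2 charF.
Qed.

Variable sigma : {rmorphism F -> F}.
Hypothesis sigma3 : forall x, sigma (sigma (sigma x)) = x.

Let perm_map (x : F) :=
  x + (x * sigma (sigma x) + x * sigma x + x + sigma x) ^+ 2.

Lemma fixed_trace0_eq0 (a : F) :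
  sigma a = a -> a + sigma a + sigma (sigma a) = 0 -> a = 0.
Proof.
by move=> fix_a; rewrite !fix_a (GRing.addrr_pchar2 charF) add0r.
Qed.

(** [sigma a] solves the same linear equation, whose root is unique as [t] is nonzero. *)
Lemma fixed_root (t a : F) : sigma t = t -> t * a + 1 = 0 -> sigma a = a.
Proof.
move=> fix_t ta1; have t_neq0 : t != 0.
  by apply/eqP=> t0; move/eqP: ta1; rewrite t0 mul0r add0r oner_eq0.
apply: (mulfI t_neq0); apply: (addIr 1).
by rewrite -{1}fix_t -rmorphM -{1}(rmorph1 sigma) -rmorphD ta1 rmorph0.
Qed.

Lemma cubic_frobenius_eq0 (s a : F) :
    sigma s = s -> a + sigma a + sigma (sigma a) = 0 ->
    sigma a ^+ 2 + a ^+ 4 + s * a ^+ 2 + a = 0 ->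
  a = 0.
Proof.
move=> fix_s tr0 E1; have [//|a_neq0] := eqVneq a 0.
have cE : sigma (sigma a) = a + sigma a.
  by apply/eqP; rewrite eq_sym -addrr_eq0 tr0.
have E2 := congr1 sigma E1.
rewrite !(rmorphD, rmorphM, rmorphXn, rmorph0) fix_s cE in E2.
(* This is the norm of [a], since [a + sigma a] is the third conjugate. *)
have n_neq0 : a * sigma a * (a + sigma a) != 0.
  by rewrite -cE !mulf_neq0 // !fmorph_eq0.
have fix_n : sigma (a * sigma a * (a + sigma a)) = a * sigma a * (a + sigma a).
  by rewrite -cE !rmorphM sigma3 mulrC mulrA.
have := conjugates_split n_neq0 E1 E2.
set r := s + _ + 1.
have fix_r : sigma r = r by rewrite /r !rmorphD fix_n fix_s rmorph1.
clearbody r; move/eqP; rewrite !mulf_eq0 -orbA => roots.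
apply: fixed_trace0_eq0 => //.
by case/or3P: roots => /eqP; apply: fixed_root;
  rewrite ?rmorphD ?rmorphXn ?rmorph1 !fix_r.
Qed.

Lemma perm_map_inj : injective perm_map.
Proof.
move=> x x'.
have [a ->] : exists a, x' = x + a by exists (x' - x); rewrite addrC subrK.
move=> E; suff -> : a = 0 by rewrite addr0.
set y := sigma x; set z := sigma y; set b := sigma a; set c := sigma b.
set T := a + b + c; set S := x + y + z.
have cycle w : sigma (w + sigma w + sigma (sigma w))
                 = w + sigma w + sigma (sigma w).
  by rewrite !rmorphD sigma3 addrC addrA.
have fix_T : sigma T = T by exact: cycle.
have fix_S : sigma S = S by exact: cycle.
have E1 : a + (x * T + a * S + a * T + a ^+ 2 + a + b) ^+ 2 = 0.
  transitivity (perm_map x + perm_map (x + a)).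
    by rewrite /perm_map !rmorphD -/y -/z -/b -/c /T /S; ring_pchar2 charF.
  by rewrite -E (GRing.addrr_pchar2 charF).
have TE : T = a + b + c by []; have SE : S = x + y + z by [].
clearbody T S.
have E2 := congr1 sigma E1.
rewrite !(rmorphD, rmorphM, rmorphXn, rmorph0) fix_T fix_S -/y -/b -/c in E2.
have E3 := congr1 sigma E2.
rewrite !(rmorphD, rmorphM, rmorphXn, rmorph0) fix_T fix_S sigma3 -/z -/c in E3.
(* The squares add up to [(S T + T S + T^2 + T^2)^2 = 0], leaving [a + b + c]. *)
have T0 : T = 0.
  transitivity ((a + (x * T + a * S + a * T + a ^+ 2 + a + b) ^+ 2)
    + (b + (y * T + b * S + b * T + b ^+ 2 + b + c) ^+ 2)
    + (c + (z * T + c * S + c * T + c ^+ 2 + c + a) ^+ 2)).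
    by rewrite TE SE; ring_pchar2 charF.
  by rewrite E1 E2 E3 !addr0.
apply: (@cubic_frobenius_eq0 (S ^+ 2 + 1)); last 2 first.
- by rewrite -T0 TE.
- by rewrite -[RHS]E1 T0; ring_pchar2 charF.
by rewrite rmorphD rmorphXn fix_S rmorph1.
Qed.

End CharacteristicTwo.

Section FrobeniusPower.

Variables (R : comNzRingType) (p m : nat).

(* The proof [charR] is a parameter so that the morphism instances below can be
   inferred from the term [frobenius_power m charR]. *)
Definition frobenius_power (charR : p \in [pchar R]) :=
  fun x : R => x ^+ (p ^ m).

Hypothesis charR : p \in [pchar R].

Local Notation phi := (frobenius_power charR).

Lemma frobenius_power_is_nmod_morphism : nmod_morphism phi.
Proof.
have p_pr := GRing.pcharf_prime charR; rewrite /frobenius_power.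
split=> [|x y]; first by rewrite expr0n expn_eq0 eqn0Ngt prime_gt0.
apply: GRing.exprDn_pchar.
by rewrite pnatX (eq_pnat _ (GRing.pcharf_eq charR)) pnat_id.
Qed.

Lemma frobenius_power_is_monoid_morphism : monoid_morphism phi.
Proof. by split=> [|x y]; rewrite /frobenius_power (expr1n, exprMn). Qed.

HB.instance Definition _ :=
  GRing.isNmodMorphism.Build R R phi frobenius_power_is_nmod_morphism.
HB.instance Definition _ :=
  GRing.isMonoidMorphism.Build R R phi frobenius_power_is_monoid_morphism.

End FrobeniusPower.

Theorem theorem3p1 (m q : nat) (m_gt0 : (0 < m)%N) (q_def : q = (2 ^ m)%N)
    (F : finFieldType) (cardF : #|F| = (q ^ 3)%N) :
  permutation_poly
    ('X + 'X^(2 * q ^ 2 + 2) + 'X^(2 * q + 2) + 'X^2 + 'X^(2 * q) : {poly F}).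
Proof.
have charF : 2%N \in [pchar F].
  by apply: (@card_finPcharP _ _ (m * 3)); rewrite // expnM -q_def.
have [sigma sigmaE] : exists sigma : {rmorphism F -> F},
    forall x, sigma x = x ^+ q.
  by exists (frobenius_power m charF) => x; rewrite q_def.
have sigma3 x : sigma (sigma (sigma x)) = x.
  by rewrite !sigmaE -!exprM -[RHS]expf_card cardF !expnS expn0 muln1 mulnA.
apply: injF_bij; apply: eq_inj (perm_map_inj charF sigma3) _ => x /=.
rewrite !(hornerD, hornerXn, hornerX) !(mulnC 2%N) !exprD -!mulnn !exprM.
rewrite -!sigmaE; ring_pchar2 charF.
Qed.
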